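(* Let $\varrho=((\rho_t^x)_{t\in\mathbb{N}_0})_{x\in E}$ be a family of dynamic conditional risk mappings such that $(\rho^x)_{x\in E}$ is regular. Let each $\rho_t^x$ be continuous from above and below, that is, $\rho_t^x(Y_n)\to\rho_t^x(Y)$ $\mathbb{P}^x$-a.s. for every $t\in\mathbb{N}_0$, $x\in E$ and every monotone sequence $(Y_n)_{n\in\mathbb{N}_0}$ in $b\mathcal{F}$ converging $\mathbb{P}^x$-a.s. to $Y\in b\mathcal{F}$. Then: (i) $\varrho$ satisfies the Markov property if and only if for all $k\ge0$ the $k$-step Markov property holds: $$\rho_t^x(f(X_{t+1},\ldots,X_{t+k}))=\rho^{X_t}(f(X_1,\ldots,X_k))\qquad\mathbb{P}^x\text{-a.s.}$$ for all $t\in\mathbb{N}_0$, $x\in E$ and bounded measurable functions $f:E^k\to\mathbb{R}$. (ii) If the family $\varrho$ is time consistent, then $\varrho$ satisfies the Markov property if and only if the one-step Markov property holds: for every $t\in\mathbb{N}_0$, $x\in E$ and bounded measurable function $f:E\to\mathbb{R}$, $$\rho_t^x(f(X_{t+1}))=\rho^{X_t}(f(X_1))\qquad\mathbb{P}^x\text{-a.s.}$$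
   Context: Setting. $E$ is a Polish space with Borel $\sigma$-algebra $\mathcal{E}$; $\mathbb{N}_0=\{0,1,2,\ldots\}$; $\Omega=E^{\mathbb{N}_0}$; $X_t(\omega)=\omega(t)$ is the coordinate process; $\mathcal{F}_t=\sigma(X_s: s\le t)$ and $\mathcal{F}=\sigma(\bigcup_t\mathcal{F}_t)$. $X$ is a time-homogeneous Markov chain; $x\mapsto\mathbb{P}^x$ is a measurable map from $E$ to the probability measures on $(\Omega,\mathcal{F})$, where $\mathbb{P}^x$ is the law of the chain started at $x$ (so $\mathbb{P}^x(X_0=x)=1$). The shifts $\theta_t:\Omega\to\Omega$ satisfy $X_s\circ\theta_t=X_{t+s}$. $b\mathcal{G}$ denotes the bounded $\mathcal{G}$-measurable real random variables. Risk mapping on $(\Omega,\mathcal{F},\mathbb{P}^x)$: a function $\rho^x:b\mathcal{F}\to\mathbb{R}$ with $\rho^x(0)=0$; $\rho^x(Z+c)=c+\rho^x(Z)$ for $Z\in b\mathcal{F}$, $c\in\mathbb{R}$; and $Z\le Z'$ $\mathbb{P}^x$-a.s. implies $\rho^x(Z)\le\rho^x(Z')$. Conditional risk mapping on $(\Omega,\mathcal{F},\mathbb{P}^x)$ with respect to $\mathcal{F}_t$: a function $\rho^x_t:b\mathcal{F}\to b\mathcal{F}_t$ with $\rho_t^x(0)=0$ $\mathbb{P}^x$-a.s.; $\rho_t^x(Z+Z')=Z'+\rho_t^x(Z)$ $\mathbb{P}^x$-a.s. for $Z\in b\mathcal{F}$, $Z'\in b\mathcal{F}_t$; and $Z\le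 Z'$ $\mathbb{P}^x$-a.s. implies $\rho_t^x(Z)\le\rho_t^x(Z')$ $\mathbb{P}^x$-a.s. Dynamic conditional risk mapping on $(\Omega,\mathcal{F},(\mathcal{F}_t),\mathbb{P}^x)$: a sequence $(\rho_t^x)_{t\in\mathbb{N}_0}$ where $\rho_0^x$ is a risk mapping and, for $t\ge1$, $\rho_t^x$ is a conditional risk mapping with respect to $\mathcal{F}_t$ (both on $(\Omega,\mathcal{F},\mathbb{P}^x)$). A family of dynamic conditional risk mappings consists of one such sequence for each $x\in E$. Write $\rho^x:=\rho_0^x$. Regularity: a collection $(\rho^x)_{x\in E}$ of risk mappings is regular if for all $Z\in b\mathcal{F}$ the map $x\mapsto\rho^x(Z)$ is bounded and measurable. Markov property: $\varrho=((\rho_t^x)_{t\in\mathbb{N}_0})_{x\in E}$ satisfies the Markov property (is Markov) if $(\rho^x_0)_{x\in E}$ is regular and for each $x\in E$, $Z\in b\mathcal{F}$, $t\in\mathbb{N}_0$: $\rho_t^x(Z\circ\theta_t)=\rho^{X_t}(Z)$ $\mathbb{P}^x$-a.s., where $\rho^{X_t}(Z)$ is the random variable $\omega\mapsto\rho^{X_t(\omega)}(Z)$. Time consistency: $\varrho$ is time consistent if for all $Y,Z\in b\mathcal{F}$, $t\in\mathbb{N}_0$, $x\in E$: $\rho^x_{t+1}(Y)\le\rho^x_{t+1}(Z)$ $\mathbb{P}^x$-a.s. implies $\rho^x_t(Y)\le\rho^x_t(Z)$ $\mathbb{P}^x$-a.s. *)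

(* Defs.v *)
From mathcomp Require Import all_boot all_order all_algebra.
From mathcomp Require Import all_classical all_reals all_analysis.
Import numFieldNormedType.Exports.

Set Implicit Arguments.
Unset Strict Implicit.
Unset Printing Implicit Defensive.

Local Open Scope classical_set_scope.
Local Open Scope ring_scope.

Definition is_metric (R : realType) (T : Type) (dist : T -> T -> R) : Prop :=
  [/\ forall x y, 0 <= dist x y,
      forall x y, dist x y = 0 <-> x = y,
      forall x y, dist x y = dist y x &
      forall x y z, dist x z <= dist x y + dist y z].

Definition metric_cauchy (R : realType) (T : Type) (dist : T -> T -> R)
    (u : nat -> T) : Prop :=
  forall e : R, 0 < e -> exists N : nat,
    forall m n : nat, (N <= m)%N -> (N <= n)%N -> dist (u m) (u n) < e.

Definition polish (R : realType) (E : topologicalType) : Prop :=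
  (exists2 D : set E, countable D & dense D) /\
  exists dist : E -> E -> R,
    [/\ is_metric dist,
        forall (x : E) (A : set E), nbhs x A <->
          exists2 e : R, 0 < e & [set y | dist x y < e] `<=` A &
        forall u : nat -> E, metric_cauchy dist u ->
          exists l : E, u @ \oo --> l].

Notation borel E := (g_sigma_algebraType (@open E)).

(* The bounded G-measurable real functions. *)
Definition bmeas (R : realType) (T : Type) (G : set (set T)) : set (T -> R) :=
  [set Z : T -> R | bounded_fun Z /\ preimage_set_system setT Z measurable `<=` G].

Section canonical_space.
Variable E : ptopologicalType.

Definition Xt (t : nat) (w : nat -> E) : borel E := w t.

Definition shift (t : nat) (w : nat -> E) : nat -> E := fun s => w (t + s)%N.

Definition filt (t : nat) : set (set (nat -> E)) :=
  <<s \bigcup_(s in [set s | (s <= t)%N])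
        preimage_set_system setT (Xt s) measurable >>.

End canonical_space.

Notation Omega E := (g_sigma_algebraType (\bigcup_t @filt E t)).

(* P is a time-homogeneous Markov chain with transition kernel pi, P x being
   its law when started at x. *)
Definition markov_chain (R : realType) (E : ptopologicalType)
    (P : R.-pker (borel E) ~> (Omega E)) : Prop :=
  (forall x : borel E, P x (Xt 0 @^-1` [set x]) = 1%E) /\
  exists pi : R.-pker (borel E) ~> (borel E),
    forall (x : borel E) (t : nat) (A : set (Omega E)) (B : set (borel E)),
      filt t A -> measurable B ->
      P x (A `&` Xt t.+1 @^-1` B) = (\int[P x]_(w in A) pi (Xt t w) B)%E.

(* A risk mapping is given by a total function on Omega -> R; only its values
   on bounded measurable functions matter. *)
Definition risk_mapping (R : realType) (E : ptopologicalType)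
    (mu : {measure set (Omega E) -> \bar R}) (r : (Omega E -> R) -> R) : Prop :=
  [/\ r (cst 0) = 0,
      forall (Z : Omega E -> R) (c : R), bmeas measurable Z ->
        r (Z \+ cst c) = c + r Z &
      forall Z Z' : Omega E -> R, bmeas measurable Z -> bmeas measurable Z' ->
        {ae mu, forall w, Z w <= Z' w} -> r Z <= r Z'].

Definition cond_risk_mapping (R : realType) (E : ptopologicalType)
    (mu : {measure set (Omega E) -> \bar R}) (t : nat)
    (r : (Omega E -> R) -> (Omega E -> R)) : Prop :=
  [/\ forall Z : Omega E -> R, bmeas measurable Z -> bmeas (@filt E t) (r Z),
      {ae mu, forall w, r (cst 0) w = 0},
      forall Z Z' : Omega E -> R, bmeas measurable Z -> bmeas (@filt E t) Z' ->
        {ae mu, forall w, r (Z \+ Z') w = Z' w + r Z w} &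
      forall Z Z' : Omega E -> R, bmeas measurable Z -> bmeas measurable Z' ->
        {ae mu, forall w, Z w <= Z' w} -> {ae mu, forall w, r Z w <= r Z' w}].

(* At time 0 the risk is a real number, at time t.+1 a random variable. *)
Record risk_family (R : realType) (E : ptopologicalType) := RiskFamily {
  risk0 : E -> (Omega E -> R) -> R ;
  riskS : nat -> E -> (Omega E -> R) -> Omega E -> R }.

Section families.
Variables (R : realType) (E : ptopologicalType).
Variable P : R.-pker (borel E) ~> (Omega E).
Variable rho : risk_family R E.

Definition risk (t : nat) (x : E) (Z : Omega E -> R) : Omega E -> R :=
  if t is s.+1 then riskS rho s x Z else cst (risk0 rho x Z).

Definition dynamic_risk_family : Prop :=
  forall x : E, risk_mapping (P x) (risk0 rho x) /\
    forall t : nat, (0 < t)%N -> cond_risk_mapping (P x) t (risk t x).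

Definition regular_risk : Prop :=
  forall Z : Omega E -> R, bmeas measurable Z ->
    bmeas (@measurable _ (borel E)) (fun x => risk0 rho x Z).

Definition continuous_above_below : Prop :=
  forall (t : nat) (x : E) (Y : nat -> Omega E -> R) (Z : Omega E -> R),
    (forall n, bmeas measurable (Y n)) -> bmeas measurable Z ->
    (forall w, nondecreasing_seq (Y ^~ w)) \/
      (forall w, nonincreasing_seq (Y ^~ w)) ->
    {ae P x, forall w, Y ^~ w @ \oo --> Z w} ->
    {ae P x, forall w, (fun n => risk t x (Y n) w) @ \oo --> risk t x Z w}.

Definition markov_property : Prop :=
  regular_risk /\
  forall (x : E) (Z : Omega E -> R) (t : nat), bmeas measurable Z ->
    {ae P x, forall w, risk t x (Z \o @shift E t) w = risk0 rho (Xt t w) Z}.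

Definition k_step_markov (k : nat) : Prop :=
  forall (t : nat) (x : E) (f : k.-tuple (borel E) -> R), bmeas measurable f ->
    {ae P x, forall w,
      risk t x (fun w' => f [tuple Xt (t + i.+1) w' | i < k]) w =
      risk0 rho (Xt t w) (fun w' => f [tuple Xt i.+1 w' | i < k])}.

Definition one_step_markov : Prop :=
  forall (t : nat) (x : E) (f : borel E -> R), bmeas measurable f ->
    {ae P x, forall w,
      risk t x (fun w' => f (Xt t.+1 w')) w =
      risk0 rho (Xt t w) (fun w' => f (Xt 1 w'))}.

Definition time_consistent : Prop :=
  forall (Y Z : Omega E -> R) (t : nat) (x : E),
    bmeas measurable Y -> bmeas measurable Z ->
    {ae P x, forall w, risk t.+1 x Y w <= risk t.+1 x Z w} ->
    {ae P x, forall w, risk t x Y w <= risk t x Z w}.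

End families.

(* Main.v *)
Require Import Defs.
From mathcomp Require Import all_boot all_order all_algebra.
From mathcomp Require Import all_classical all_reals all_analysis.
From mathcomp Require Import measurable_realfun ring lra.
Import Order.TTheory GRing.Theory Num.Theory numFieldNormedType.Exports HBNNSimple.

Set Implicit Arguments.
Unset Strict Implicit.
Unset Printing Implicit Defensive.

Local Open Scope classical_set_scope.
Local Open Scope ring_scope.

(* The functions Z with rho_t^x(Z o theta_t) = rho^{X_t}(Z) a.s. do not form a
   vector space, since rho is nonlinear, but by continuity they are closed under
   bounded monotone limits.  It therefore suffices to find in this class a vector
   lattice with constants that generates the sigma-algebra: the monotone closure
   of such a lattice is again a lattice, hence contains all bounded measurable
   functions.

   The k-step property does not mention X_0, whereas Z may depend on it.  For Z
   depending on X_0 through a finite partition this is repaired by locality: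
   monotonicity and translation invariance force rho_t(Z) = rho_t(Z') on every
   event of F_t where Z = Z'.  Such Z form a lattice.

   For (ii), put Z = f(X_0, ..., X_k) and F(y) = rho^y(Z).  By the k-step case
   rho_{t+1}(Z o theta_{t+1}) = F(X_{t+1}) = rho_{t+1}(F(X_{t+1})), so time
   consistency gives rho_t(Z o theta_{t+1}) = rho_t(F(X_{t+1})), and the one-step
   property turns this into the (k+1)-step one. *)

(** * Boundedness by an explicit constant *)

Definition ubounded (R : realType) (T : Type) (Z : T -> R) : Prop :=
  exists C : R, forall w, `|Z w| <= C.

Lemma bounded_funE (R : realType) (T : Type) (Z : T -> R) :
  bounded_fun Z <-> ubounded Z.
Proof.
split=> [[M [_ ZM]]|[C ZC]].
- exists (M + 1) => w; apply: (ZM (M + 1) _ w I).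
  by rewrite ltrDl.
- exists C; split; first exact: num_real.
  by move=> M CM w _; exact: le_trans (ZC w) (ltW CM).
Qed.

Lemma bmeasP (R : realType) d (T : measurableType d) (Z : T -> R) :
  bmeas measurable Z <-> ubounded Z /\ measurable_fun setT Z.
Proof.
split=> [[/bounded_funE bZ mZ]|[/bounded_funE bZ mZ]]; split=> //.
- by move=> _ B mB; apply: mZ; exists B.
- by move=> _ [B mB <-]; exact: mZ.
Qed.

(** * Closure under bounded monotone limits *)

Section monotone_closure.
Variables (R : realType) (T : Type).
Implicit Types (L K : set (T -> R)) (Y Z : T -> R).

Definition monotone_limit (Y : nat -> T -> R) Z : Prop :=
  ((forall w, nondecreasing_seq (Y ^~ w)) \/
   (forall w, nonincreasing_seq (Y ^~ w))) /\
  forall w, Y ^~ w @ \oo --> Z w.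

Definition limit_closed K : Prop := forall (Y : nat -> T -> R) Z,
  (forall n, K (Y n)) -> ubounded Z -> monotone_limit Y Z -> K Z.

(** As the intersection of all limit-closed classes above [L], it carries its own induction
    principle: membership is applied to a suitable [K]. *)
Definition monotone_closure L : set (T -> R) :=
  [set Z | forall K, limit_closed K -> L `<=` K -> K Z].

Lemma monotone_closure_sub L : L `<=` monotone_closure L.
Proof. by move=> Z LZ K _; apply. Qed.

Lemma monotone_closure_limit L : limit_closed (monotone_closure L).
Proof.
move=> Y Z LY bZ YZ K Klim LK; apply: (Klim Y) => // n.
exact: LY.
Qed.

Lemma monotone_closure_bounded L :
  L `<=` ubounded (T:=T) -> monotone_closure L `<=` ubounded (T:=T).
Proof. by move=> bL Z; apply => // Y Z'. Qed.

(** Continuity of [h w] preserves limits, and its monotonicity keeps or reverses their direction; so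
    the bounded functions sent into the closure by [h] form a limit-closed class containing [L]. *)
Lemma monotone_closure_map L (h : T -> R -> R) :
  L `<=` ubounded (T := T) ->
  (forall w, continuous (h w)) ->
  (forall w, {homo h w : a b / a <= b}) \/
    (forall w, {homo h w : a b /~ a <= b}) ->
  (forall Y, ubounded Y -> ubounded (fun w => h w (Y w))) ->
  (forall Y, L Y -> monotone_closure L (fun w => h w (Y w))) ->
  forall Y, monotone_closure L Y -> monotone_closure L (fun w => h w (Y w)).
Proof.
move=> bL hc hm hb hL Y LY.
pose K := [set Z | ubounded Z /\ monotone_closure L (fun w => h w (Z w))].
suff: K Y by case.
apply: LY => [X Z KX bZ [Xm XZ]|Z LZ]; last by split; [exact: bL|exact: hL].
split=> //; apply: (@monotone_closure_limit L (fun n w => h w (X n w))).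
- by move=> n; case: (KX n).
- exact: hb.
- split; last by move=> w; exact: (cvg_comp _ _ (XZ w) (hc w (Z w))).
  case: hm => hm; case: Xm => Xm.
  + by left=> w m n mn; apply/hm/Xm.
  + by right=> w m n mn; apply/hm/Xm.
  + by right=> w m n mn; apply/hm/Xm.
  + by left=> w m n mn; apply/hm/Xm.
Qed.

End monotone_closure.

(** * Function lattices and their monotone closure *)

Section bounded_operations.
Variables (R : realType) (T : Type).
Implicit Types Y Z : T -> R.

Lemma ubounded_cst (a : R) : ubounded (cst a : T -> R).
Proof. by exists `|a|. Qed.

Lemma uboundedD Y Z : ubounded Y -> ubounded Z ->
  ubounded (fun w => Y w + Z w).
Proof.
by move=> [C YC] [D ZD]; exists (C + D) => w; rewrite (le_trans (ler_normD _ _)) ?lerD.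
Qed.

Lemma uboundedZ (a : R) Z : ubounded Z -> ubounded (fun w => a * Z w).
Proof.
by move=> [C ZC]; exists (`|a| * C) => w; rewrite normrM ler_wpM2l.
Qed.

Lemma ubounded_max Y Z : ubounded Y -> ubounded Z ->
  ubounded (fun w => Num.max (Y w) (Z w)).
Proof.
move=> [C YC] [D ZD]; exists (Num.max C D) => w.
by case: (leP (Y w) (Z w)) => _; rewrite le_max ?YC ?ZD ?orbT.
Qed.

End bounded_operations.

Definition function_lattice (R : realType) (T : Type) (L : set (T -> R)) : Prop :=
  [/\ L `<=` ubounded (T := T), L (cst 1),
      forall Y Z, L Y -> L Z -> L (fun w => Y w + Z w),
      forall a Z, L Z -> L (fun w => a * Z w) &
      forall Y Z, L Y -> L Z -> L (fun w => Num.max (Y w) (Z w))].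

Section monotone_closure_lattice.
Variables (R : realType) (T : Type).
Implicit Types (L K : set (T -> R)) (Y Z : T -> R).

(** Binary operations take two passes: first one operand stays in [L], then commutativity lets both
    range over the closure. *)
Lemma monotone_closure_lattice L :
  function_lattice L -> function_lattice (monotone_closure L).
Proof.
move=> [bL L1 LD LZ LM]; have bM := monotone_closure_bounded bL.
have sub := @monotone_closure_sub _ _ L.
have max_cont (a : R) : continuous (Num.max a).
  by move=> r; apply: (@continuous_max R R^o (cst a) id r); [exact: cvg_cst|exact: cvg_id].
have max_homo (a : R) : {homo Num.max a : b c / b <= c}.
  by move=> b c bc; rewrite ge_max !le_max lexx bc orbT.
have Dl Y : L Y -> forall Z, monotone_closure L Z ->
    monotone_closure L (fun w => Y w + Z w).
  move=> LY; apply: (monotone_closure_map (h := fun w r => Y w + r)) => //.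
  - by move=> w r; apply: cvgD; [exact: cvg_cst|exact: cvg_id].
  - by left=> w a b; rewrite lerD2l.
  - by move=> Z bZ; apply: uboundedD => //; exact: bL.
  - by move=> Z LZ'; apply: sub; exact: LD.
have Ml Y : L Y -> forall Z, monotone_closure L Z ->
    monotone_closure L (fun w => Num.max (Y w) (Z w)).
  move=> LY; apply: (monotone_closure_map (h := fun w => Num.max (Y w))) => //.
  - by left.
  - by move=> Z bZ; apply: ubounded_max => //; exact: bL.
  - by move=> Z LZ'; apply: sub; exact: LM.
split=> //; first exact: sub.
- move=> Y Z MY; apply: (monotone_closure_map (h := fun w r => Y w + r)) => //.
  - by move=> w r; apply: cvgD; [exact: cvg_cst|exact: cvg_id].
  - by left=> w a b; rewrite lerD2l.
  - by move=> X bX; apply: uboundedD => //; exact: bM.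
  - by move=> X LX; under eq_fun do rewrite addrC; exact: Dl.
- move=> a; apply: (monotone_closure_map (h := fun _ r => a * r)) => //.
  - by move=> w r; apply: cvgM; [exact: cvg_cst|exact: cvg_id].
  (* A negative [a] turns increasing limits into decreasing ones; the closure admits both. *)
  - have [a0|a0] := leP 0 a; [left|right] => _ b c bc; first exact: ler_wpM2l.
    by rewrite ler_wnM2l // ltW.
  - by move=> X; exact: uboundedZ.
  - by move=> X LX; apply: sub; exact: LZ.
- move=> Y Z MY; apply: (monotone_closure_map (h := fun w => Num.max (Y w))) => //.
  - by left.
  - by move=> X bX; apply: ubounded_max => //; exact: bM.
  - by move=> X LX; under eq_fun do rewrite maxC; exact: Ml.
Qed.

End monotone_closure_lattice.

(** * A monotone class theorem for lattices *)

Section lattice_monotone_class.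
Variables (R : realType) (T : pointedType) (G : set (set T)) (M : set (T -> R)).
Hypotheses (M_lattice : function_lattice M) (M_limit : limit_closed M).
Hypothesis M_indic : forall A, G A -> M \1_A.

Lemma lattice_cst (a : R) : M (cst a).
Proof.
have [_ M1 _ MZ _] := M_lattice.
have := MZ a _ M1; congr M; apply/funext => w /=; exact: mulr1.
Qed.

(** The sets with indicator in [M] form a sigma-algebra: complements come from 1 - 1_B, finite
    unions from maxima, countable unions from increasing limits. *)
Lemma lattice_indic (A : set T) : <<s G >> A -> M \1_A.
Proof.
have [bM M1 MD MZ MM] := M_lattice.
suff: <<s G >> `<=` [set B | M \1_B] by apply.
apply: smallest_sub => /=; [split=> /=|exact: M_indic].
- by rewrite indic0; exact: lattice_cst.
- move=> B MB; rewrite setTD.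
  have := MD _ _ M1 (MZ (-1) _ MB); congr M; apply/funext => w /=.
  by rewrite indicC indicE; case: (_ \in _) => /=; ring.
- move=> F MF; pose U n := \big[setU/set0]_(i < n) F i.
  apply: (M_limit (Y := fun n => \1_(U n))).
  + elim=> [|n IH]; first by rewrite /U big_ord0 indic0; exact: lattice_cst.
    have := MM _ _ IH (MF n); congr M; apply/funext => w /=.
    rewrite /U big_ord_recr /= !indicE in_setU.
    by case: (_ \in _); case: (_ \in _); rewrite ?maxxx // /Num.max ?ltr01 ?ltr10.
  + by exists 1 => w; rewrite indicE; case: (_ \in _); rewrite ?normr1 ?normr0.
  + split.
      left=> w m n mn; rewrite !indicE ler_nat.
      have [wm|//] := boolP (w \in U m).
      by rewrite mem_set //; apply: (subset_bigsetU mn); exact: set_mem.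
    move=> w; have [/set_mem[N _ wN]|wU] := boolP (w \in \bigcup_n F n).
      rewrite indicE mem_set; last by exists N.
      apply: cvg_near_cst; exists N.+1 => // n Nn; rewrite indicE mem_set //.
      by rewrite /U -bigcup_mkord; exists N.
    rewrite indicE (negbTE wU); apply: cvg_near_cst; apply: nearW => n.
    rewrite indicE memNset // /U -bigcup_mkord => -[k _ Fk].
    by move/negP: wU; apply; apply/mem_set; exists k.
Qed.

Lemma lattice_sum (I : Type) (r : seq I) (F : I -> T -> R) :
  (forall i, M (F i)) -> M (fun w => \sum_(i <- r) F i w).
Proof.
have [_ _ MD _ _] := M_lattice.
move=> MF; elim: r => [|i r IH].
  by under eq_fun do rewrite big_nil; exact: lattice_cst.
by under eq_fun do rewrite big_cons; exact: MD.
Qed.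

Lemma lattice_monotone_class (Z : T -> R) : bmeas <<s G >> Z -> M Z.
Proof.
have [bM M1 MD MZ MM] := M_lattice.
move=> /(@bmeasP _ _ (g_sigma_algebraType G))[[C ZC] mZ].
(* Shifting by the bound [C] gives a nonnegative function, hence an increasing limit of simple
   functions. *)
pose W : g_sigma_algebraType G -> R := fun w => Z w + C.
have W0 w : 0 <= W w by rewrite -lerBlDr sub0r; have /ler_normlP[] := ZC w; lra.
have mW : measurable_fun [set: g_sigma_algebraType G] (EFin \o W).
  by apply/measurable_EFinP; exact: measurable_funD.
suff MW : M W.
  have := MD _ _ MW (lattice_cst (- C)); congr M; apply/funext => w.
  by rewrite /W addrK.
apply: (M_limit (Y := fun n => nnsfun_approx measurableT mW n : T -> R)).
- move=> n; pose f := nnsfun_approx measurableT mW n.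
  pose s := finmap.enum_fset (fset_set (range f)).
  have -> : (f : T -> R) = fun w : T => \sum_(y <- s) y * \1_(f @^-1` [set y]) w.
    by apply/funext => w; rewrite fimfunE fsbig_finite.
  apply: (@lattice_sum _ _ (fun y w => y * \1_(f @^-1` [set y]) w)) => y.
  apply: MZ; apply: lattice_indic.
  exact: (@measurable_funPTI _ _ (g_sigma_algebraType G) _ f).
- by apply: uboundedD; [exists C|exact: ubounded_cst].
- split; first by left=> w m n mn; have /lefP := nd_nnsfun_approx measurableT mW mn; exact.
  move=> w; have W0' x : setT x -> (0 <= (EFin \o W) x)%E by rewrite lee_fin.
  by have /fine_cvgP[] := cvg_nnsfun_approx measurableT mW W0' (I : setT w).
Qed.

End lattice_monotone_class.

(** The lattice structure is asked of [L] alone. The class [K] is only limit-closed, as befits a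
    class defined through the nonlinear risk mappings. *)
Lemma functional_monotone_class (R : realType) (T : pointedType)
    (G : set (set T)) (L K : set (T -> R)) :
  function_lattice L -> (forall A, G A -> L \1_A) ->
  L `<=` K -> limit_closed K -> bmeas <<s G >> `<=` K.
Proof.
move=> Llat LG LK Klim Z bZ.
suff: monotone_closure L Z by apply.
apply: lattice_monotone_class bZ; first exact: monotone_closure_lattice.
- exact: monotone_closure_limit.
- by move=> A GA; apply: monotone_closure_sub; exact: LG.
Qed.

(** * Bounded measurable functions *)

Lemma bmeas_sub (R : realType) (T : Type) (G G' : set (set T)) :
  G `<=` G' -> bmeas (R := R) G `<=` bmeas G'.
Proof. by move=> GG' Z [bZ mZ]; split=> //; exact: subset_trans mZ GG'. Qed.

Lemma bmeas_cst (R : realType) d (T : measurableType d) (a : R) :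
  bmeas measurable (cst a : T -> R).
Proof. by apply/bmeasP; split; [exact: ubounded_cst|exact: measurable_cst]. Qed.

Lemma bmeas_comp (R : realType) d d' (T : measurableType d)
    (T' : measurableType d') (f : T' -> R) (g : T -> T') :
  bmeas measurable f -> measurable_fun setT g -> bmeas measurable (f \o g).
Proof.
move=> /bmeasP[[C fC] mf] mg; apply/bmeasP; split; first by exists C => w; exact: fC.
exact: measurableT_comp.
Qed.

Lemma bmeas_lattice (R : realType) d (T : measurableType d) :
  function_lattice (bmeas (R := R) (@measurable d T)).
Proof.
split.
- by move=> Z /bmeasP[].
- exact: bmeas_cst.
- move=> Y Z /bmeasP[bY mY] /bmeasP[bZ mZ]; apply/bmeasP; split.
    exact: uboundedD.
  exact: measurable_funD.
- move=> a Z /bmeasP[bZ mZ]; apply/bmeasP; split; first exact: uboundedZ.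
  exact: measurable_funM.
- move=> Y Z /bmeasP[bY mY] /bmeasP[bZ mZ]; apply/bmeasP; split.
    exact: ubounded_max.
  exact: measurable_maxr.
Qed.

Lemma bmeasM (R : realType) d (T : measurableType d) (Y Z : T -> R) :
  bmeas measurable Y -> bmeas measurable Z ->
  bmeas measurable (fun w => Y w * Z w).
Proof.
move=> /bmeasP[[C YC] mY] /bmeasP[[D ZD] mZ]; apply/bmeasP; split.
  by exists (C * D) => w; rewrite normrM ler_pM.
exact: measurable_funM.
Qed.

Lemma bmeas_indic (R : realType) d (T : measurableType d) (A : set T) :
  measurable A -> bmeas measurable (\1_A : T -> R).
Proof.
move=> mA; apply/bmeasP; split; last exact: measurable_indic.
by exists 1 => w; rewrite indicE; case: (_ \in _); rewrite ?normr1 ?normr0.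
Qed.

(** * Measurability on the path space *)

(** Naming the generators of [filt t] makes it the sigma-algebra of a measurable type, so that the
    lemmas on [bmeas measurable] apply to it. *)
Definition coordinate_events (E : ptopologicalType) (t : nat) : set (set (nat -> E)) :=
  \bigcup_(s in [set s | (s <= t)%N]) preimage_set_system setT (@Xt E s) measurable.

Section canonical_measurability.
Variable E : ptopologicalType.

Lemma filt_Xt s t (B : set (borel E)) : (s <= t)%N -> measurable B ->
  @filt E t (Xt s @^-1` B).
Proof.
move=> st mB; apply: sub_sigma_algebra; exists s => //.
by exists B => //; rewrite setTI.
Qed.

Lemma filt_measurable t : @filt E t `<=` @measurable _ (Omega E).
Proof. by move=> A tA; apply: sub_sigma_algebra; exists t. Qed.

Lemma filt_le s t : (s <= t)%N -> @filt E s `<=` @filt E t.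
Proof.
move=> st; apply: sub_sigma_algebra2 => A [i /= si iA]; exists i => //=.
exact: leq_trans st.
Qed.

(** Sets with measurable preimage form a sigma-algebra, so coordinate events suffice; they are
    reached through two levels of generation, first the [filt t], then the coordinates. *)
Lemma measurable_path d (T : measurableType d) (F : T -> Omega E) :
  (forall s, measurable_fun setT (Xt s \o F : T -> borel E)) ->
  measurable_fun setT F.
Proof.
move=> mF; suff: @measurable _ (Omega E) `<=` image_set_system setT F measurable.
  by move=> FO _ A mA; exact: FO.
have salg := sigma_algebra_image F (@sigma_algebra_measurable _ T).
apply: smallest_sub => // A [t _].
apply: smallest_sub => // {}A [s _ [B mB <-]].
by rewrite setTI; exact: (mF s measurableT B mB).
Qed.

Lemma measurable_Xt t : measurable_fun setT (Xt t : Omega E -> borel E).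
Proof.
by move=> _ B mB; rewrite setTI; apply: filt_measurable; exact: (filt_Xt (leqnn t)).
Qed.

Lemma measurable_shift t : measurable_fun setT (@Defs.shift E t : Omega E -> Omega E).
Proof. by apply: measurable_path => s; exact: (@measurable_Xt (t + s)). Qed.

(** The free index map covers tuples starting at X_0 as well as those starting at X_1. *)
Lemma bmeas_filt_tuple (R : realType) t k (f : k.-tuple (borel E) -> R)
    (idx : 'I_k -> nat) :
  bmeas measurable f -> (forall i, (idx i <= t)%N) ->
  bmeas (@filt E t) (fun w => f [tuple Xt (idx i) w | i < k]).
Proof.
move=> bf idxt.
pose T := g_sigma_algebraType (@coordinate_events E t).
apply: (@bmeas_comp R _ _ T _ f) => //.
apply/measurable_fun_tnthP => i _ B mB; rewrite setTI.
rewrite (_ : _ @^-1` _ = Xt (idx i) @^-1` B); first exact: filt_Xt.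
by apply/seteqP; split=> w /=; rewrite tnth_mktuple.
Qed.

End canonical_measurability.

(** * Locality of conditional risk mappings *)

Section risk.
Variables (R : realType) (E : ptopologicalType).

(** Adding to [Z'] a large multiple of the indicator of the complement of [A] makes it dominate [Z]
    everywhere. This penalty is F_t-measurable, so translation pulls it out, and it vanishes on [A].
    Symmetry gives equality. *)
Lemma cond_risk_local (mu : {measure set (Omega E) -> \bar R}) t r
    (A : set (Omega E)) (Z Z' : Omega E -> R) :
  cond_risk_mapping mu t r -> filt t A ->
  bmeas measurable Z -> bmeas measurable Z' -> (forall w, A w -> Z w = Z' w) ->
  {ae mu, forall w, A w -> r Z w = r Z' w}.
Proof.
move=> [_ _ rD rle] tA.
suff le Y Y' : bmeas measurable Y -> bmeas measurable Y' ->
    (forall w, A w -> Y w = Y' w) -> {ae mu, forall w, A w -> r Y w <= r Y' w}.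
  move=> bZ bZ' ZZ'.
  have ZZ'le := le _ _ bZ bZ' ZZ'.
  have Z'Zle := le _ _ bZ' bZ (fun w Aw => esym (ZZ' w Aw)).
  apply: filterS2 ZZ'le Z'Zle => w l1 l2 Aw.
  by apply: le_anti; rewrite l1 ?l2.
move=> bY bY' YY'.
have [[C YC] _] := (bmeasP _).1 bY; have [[D YD] _] := (bmeasP _).1 bY'.
pose T := g_sigma_algebraType (@coordinate_events E t).
(* [C + D] bounds Y - Y' from above. *)
pose W := fun w : Omega E => (C + D) * \1_(~` A) w.
have tW : bmeas (@filt E t) W.
  have [_ _ _ MZ _] := bmeas_lattice R T.
  by apply: MZ; apply: bmeas_indic; apply: measurableC.
have bW : bmeas measurable W := bmeas_sub (@filt_measurable E t) tW.
have bYW : bmeas measurable (Y' \+ W).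
  by have [_ _ MD _ _] := bmeas_lattice R (Omega E); exact: MD.
have leYW : {ae mu, forall w, Y w <= (Y' \+ W) w}.
  apply: aeW => w /=; rewrite /W indicE.
  have [wA|wA] := boolP (w \in A).
    by rewrite memNset ?mulr0 ?addr0 ?YY' //; [exact: set_mem|apply; exact: set_mem].
  rewrite mem_set ?mulr1; last by move=> Aw; move/negP: wA; apply; exact: mem_set.
  by have /ler_normlP[] := YC w; have /ler_normlP[] := YD w; lra.
apply: filterS2 (rle _ _ bY bYW leYW) (rD _ _ bY' tW) => w le1 eq1 Aw.
by move: le1; rewrite eq1 /W indicE memNset ?mulr0 ?add0r //; exact.
Qed.

End risk.

(** * Elementary properties of the risk family *)

Section risk_family.
Variables (R : realType) (E : ptopologicalType).
Variables (P : R.-pker (borel E) ~> (Omega E)) (rho : risk_family R E).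
Hypothesis rho_dyn : dynamic_risk_family P rho.

(** A probability measure is nonzero. This turns almost sure statements about time 0, where the risk
    is a number, into plain ones. *)
Lemma ae_cst (x : E) (Q : Prop) : {ae P x, forall w, Q} -> Q.
Proof.
have Px : (0 < P x setT)%E by rewrite prob_kernel lte01.
have FF := ae_properfilter_algebraOfSetsType Px.
by move=> /filter_const.
Qed.

Lemma risk0_ext (x : E) (Y Z : Omega E -> R) :
  bmeas measurable Y -> bmeas measurable Z ->
  {ae P x, forall w, Y w = Z w} -> risk0 rho x Y = risk0 rho x Z.
Proof.
have [[_ _ rle] _] := rho_dyn x.
move=> bY bZ YZ; apply: le_anti; apply/andP; split; apply: rle => //.
  by apply: filterS YZ => w ->.
by apply: filterS YZ => w ->.
Qed.

Lemma riskS_measurable t (x : E) (Z : Omega E -> R) :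
  bmeas (@filt E t.+1) Z -> {ae P x, forall w, risk rho t.+1 x Z w = Z w}.
Proof.
have [_ /(_ t.+1 isT)[_ r0 rD _]] := rho_dyn x.
move=> bZ; apply: filterS2 r0 (rD _ _ (bmeas_cst _ 0) bZ) => w r0 rD'.
have -> : Z = (cst 0 \+ Z :> (Omega E -> R)).
  by apply/funext => w' /=; rewrite add0r.
by rewrite rD' r0 addr0 /= add0r.
Qed.

Lemma risk_cst t (x : E) (a : R) :
  {ae P x, forall w, risk rho t x (cst a) w = a}.
Proof.
case: t => [|t]; last first.
  apply: riskS_measurable.
  exact: (bmeas_cst (g_sigma_algebraType _)).
apply: aeW => w /=; have [[r0 rD _] _] := rho_dyn x.
have := rD _ a (bmeas_cst _ 0); rewrite r0 addr0.
by congr (risk0 _ _ _ = _); apply/funext => w' /=; rewrite add0r.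
Qed.

(** * The Markov identity for a single Z, and its stability under limits *)

Hypothesis start : forall x : E, {ae P x, forall w : Omega E, Xt 0 w = x :> E}.
Hypothesis rho_cont : continuous_above_below P rho.

Definition markov_at (Z : Omega E -> R) : Prop := forall x t,
  {ae P x, forall w, risk rho t x (Z \o @Defs.shift E t) w = risk0 rho (Xt t w) Z}.

Lemma markov_at_limit : limit_closed (bmeas measurable `&` markov_at).
Proof.
move=> Y Z HY bZ [Ym YZ].
have bY n : bmeas measurable (Y n) by case: (HY n).
have {}bZ : bmeas measurable Z.
  apply/bmeasP; split=> //; apply: (measurable_fun_cvg (h := Y)) => // n.
  by have /bmeasP[] := bY n.
split=> // x t.
have cvgt : {ae P x, forall w,
    risk rho t x (Y n \o @Defs.shift E t) w @[n --> \oo] -->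
    risk rho t x (Z \o @Defs.shift E t) w}.
  apply: (@rho_cont t x (fun n => Y n \o @Defs.shift E t) (Z \o @Defs.shift E t)).
  - by move=> n; apply: bmeas_comp => //; exact: measurable_shift.
  - by apply: bmeas_comp => //; exact: measurable_shift.
  - by case: Ym => Ym; [left|right] => w; exact: Ym.
  - by apply: aeW => w; exact: YZ.
(* At time 0 the convergence holds for every [y] without exception, hence at the random point
   X_t(w). *)
have cvg0 (y : E) : risk0 rho y (Y n) @[n --> \oo] --> risk0 rho y Z.
  apply: (@ae_cst y); apply: (@rho_cont 0 y Y Z) => //.
  by apply: aeW => w; exact: YZ.
(* Countably many identities share one null set. *)
have eqn : {ae P x, forall w n,
    risk rho t x (Y n \o @Defs.shift E t) w = risk0 rho (Xt t w) (Y n)}.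
  by apply: ae_foralln => n; case: (HY n) => _; exact.
apply: filterS2 cvgt eqn => w cvgw eqw.
apply/esym; apply: cvg_unique (cvg0 (Xt t w)) _; first exact: Rhausdorff.
have /= <- : (fun n => risk rho t x (Y n \o @Defs.shift E t) w) =
  (fun n => risk0 rho (Xt t w) (Y n)) by apply/funext.
exact: cvgw.
Qed.

Lemma markov_at0 (Z : Omega E -> R) (x : E) :
  {ae P x, forall w,
    risk rho 0 x (Z \o @Defs.shift E 0) w = risk0 rho (Xt 0 w) Z}.
Proof. by apply: filterS (start x) => w /= ->. Qed.

(* The fibers of phi are the finite partition through which Z sees X_0. *)
Definition finite_start k : set (Omega E -> R) :=
  [set Z | exists (T : finType) (phi : borel E -> T)
      (g : T -> k.-tuple (borel E) -> R),
    [/\ forall a, measurable (phi @^-1` [set a]),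
        forall a, bmeas measurable (g a) &
        Z = fun w => g (phi (Xt 0 w)) [tuple Xt i.+1 w | i < k]]].

Lemma finite_start_bmeas k : finite_start k `<=` bmeas measurable.
Proof.
move=> _ [T [phi [g [mphi bg ->]]]].
(* Expanding over the cells leaves a finite sum in which each [g a] has a fixed first argument. *)
have -> : (fun w : Omega E => g (phi (Xt 0 w)) [tuple Xt i.+1 w | i < k]) =
    (fun w => \sum_(a : T) \1_(phi @^-1` [set a]) (Xt 0 w) *
      g a [tuple Xt i.+1 w | i < k]).
  apply/funext => w; rewrite (bigD1 (phi (Xt 0 w))) //= big1 ?addr0.
    by rewrite indicE mem_set // mul1r.
  by move=> a /eqP aw; rewrite indicE memNset ?mul0r //= => /esym.
apply: (lattice_sum (bmeas_lattice R (Omega E))) => a; apply: bmeasM.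
  apply: (@bmeas_comp R _ _ (Omega E) (borel E) \1_(phi @^-1` [set a]) (Xt 0)).
    exact: bmeas_indic.
  exact: measurable_Xt.
apply: (bmeas_sub (@filt_measurable E k)).
by apply: (@bmeas_filt_tuple E R k k (g a) (fun i => i.+1)).
Qed.

(** Two members are combined over the product of their partitions. *)
Lemma finite_start_lattice k : function_lattice (finite_start k).
Proof.
have [_ _ MD MZ MM] := bmeas_lattice R (k.-tuple (borel E)).
split.
- by move=> Z /finite_start_bmeas/bmeasP[].
- exists unit, (fun=> tt), (fun _ => cst 1); split=> //.
  + by case; rewrite (_ : _ @^-1` _ = setT) //; apply/seteqP; split.
  + by move=> _; exact: bmeas_cst.
- move=> _ _ [T1 [phi1 [g1 [m1 b1 ->]]]] [T2 [phi2 [g2 [m2 b2 ->]]]].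
  exists (T1 * T2)%type, (fun x => (phi1 x, phi2 x)),
    (fun a u => g1 a.1 u + g2 a.2 u); split=> //.
  + move=> [a b]; rewrite (_ : _ @^-1` _ =
      phi1 @^-1` [set a] `&` phi2 @^-1` [set b]); first exact: measurableI.
    by apply/seteqP; split=> y /= [-> ->].
  + by move=> a; exact: MD.
- move=> c _ [T [phi [g [mphi bg ->]]]].
  by exists T, phi, (fun a u => c * g a u); split=> // a; exact: MZ.
- move=> _ _ [T1 [phi1 [g1 [m1 b1 ->]]]] [T2 [phi2 [g2 [m2 b2 ->]]]].
  exists (T1 * T2)%type, (fun x => (phi1 x, phi2 x)),
    (fun a u => Num.max (g1 a.1 u) (g2 a.2 u)); split=> //.
  + move=> [a b]; rewrite (_ : _ @^-1` _ =
      phi1 @^-1` [set a] `&` phi2 @^-1` [set b]); first exact: measurableI.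
    by apply/seteqP; split=> y /= [-> ->].
  + by move=> a; exact: MM.
Qed.

(** At time 0 the set [B] is itself a two-cell partition. At a later time the partition is trivial
    and the coordinate X_{s+1} is entry [s] of the tuple. *)
Lemma finite_start_indic k s (B : set (borel E)) : (s <= k)%N -> measurable B ->
  finite_start k \1_(Xt s @^-1` B).
Proof.
case: s => [|s] sk mB.
  exists bool, (fun x => x \in B), (fun b : bool => cst b%:R); split=> //.
  - case.
      rewrite (_ : _ @^-1` _ = B) //; apply/seteqP; split=> y /=.
        exact: set_mem.
      exact: mem_set.
    rewrite (_ : _ @^-1` _ = ~` B); first exact: measurableC.
    apply/seteqP; split=> y /= yB; last exact: memNset.
    by move/mem_set; rewrite yB.
  - by move=> b; exact: bmeas_cst.
exists unit, (fun=> tt), (fun _ u => \1_B (tnth u (Ordinal sk))); split=> //.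
- by case; rewrite (_ : _ @^-1` _ = setT) //; apply/seteqP; split.
- move=> _; apply: (@bmeas_comp R _ _ (k.-tuple (borel E)) (borel E)
    \1_B (fun u => tnth u _)).
    exact: bmeas_indic.
  exact: measurable_tnth.
- by apply/funext => w; rewrite tnth_mktuple.
Qed.

Lemma finite_start_markov k : k_step_markov P rho k ->
  finite_start k `<=` markov_at.
Proof.
move=> kstep Z Zk; have bZ := finite_start_bmeas Zk.
move: Zk bZ => [T [phi [g [mphi bg ZE]]]] bZ x [|t]; first exact: markov_at0.
pose tail a := fun w : Omega E => g a [tuple Xt i.+1 w | i < k].
have btail a : bmeas measurable (tail a).
  apply: (bmeas_sub (@filt_measurable E k)).
  by apply: (@bmeas_filt_tuple E R k k (g a) (fun i => i.+1)).
(* X_0 = y almost surely under [P y], so the cell is frozen. *)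
have startE y : risk0 rho y Z = risk0 rho y (tail (phi y)).
  apply: risk0_ext => //; apply: filterS (start y) => w wy.
  by rewrite ZE wy.
have [_ /(_ t.+1 isT) cond] := rho_dyn x.
(* The shifted cell is an event at time [t.+1], so locality freezes it there too. *)
have cell a : {ae P x, forall w : Omega E, phi (Xt t.+1 w) = a ->
    risk rho t.+1 x (Z \o @Defs.shift E t.+1) w =
    risk rho t.+1 x (tail a \o @Defs.shift E t.+1) w}.
  apply: (cond_risk_local cond (A := Xt t.+1 @^-1` (phi @^-1` [set a]))).
  - exact: (filt_Xt (leqnn _)).
  - by apply: bmeas_comp => //; exact: measurable_shift.
  - by apply: bmeas_comp => //; exact: measurable_shift.
  - by move=> w /= <-; rewrite ZE /tail /Xt /Defs.shift addn0.
have aeF := ae_filter_ringOfSetsType (P x).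
(* There are finitely many cells, so a single null set serves all [a], and [a] may be chosen as
   phi(X_{t+1}(w)). *)
have := filter_forall aeF
  (fun a => @filterI _ _ aeF _ _ (cell a) (kstep t.+1 x (g a) (bg a))).
apply: filterS => w /(_ (phi (Xt t.+1 w)))[/(_ erefl) -> eqk].
by rewrite startE -eqk.
Qed.

(** * From the k-step properties to the Markov property and back *)

Lemma k_step_filt k : k_step_markov P rho k -> bmeas (@filt E k) `<=` markov_at.
Proof.
move=> kstep Z bZ.
suff: (bmeas measurable `&` markov_at) Z by case.
apply: (@functional_monotone_class _ _ _ (finite_start k)) bZ.
- exact: finite_start_lattice.
- by move=> _ [s /= sk [B mB <-]]; rewrite setTI; exact: finite_start_indic.
- by move=> Y Yk; split; [exact: finite_start_bmeas Yk|exact: finite_start_markov Yk].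
- exact: markov_at_limit.
Qed.

(** A second monotone class argument, starting from functions of finitely many coordinates; they
    form a lattice because the filtration increases. *)
Lemma k_steps_markov : (forall k, k_step_markov P rho k) ->
  bmeas measurable `<=` markov_at.
Proof.
move=> kstep Z bZ.
suff: (bmeas measurable `&` markov_at) Z by case.
have filt_lat k := bmeas_lattice R (g_sigma_algebraType (@coordinate_events E k)).
have up k l Y : (k <= l)%N -> bmeas (@filt E k) Y -> bmeas (R := R) (@filt E l) Y.
  by move=> kl; apply: bmeas_sub; exact: filt_le.
apply: (@functional_monotone_class _ _ _ (\bigcup_k bmeas (@filt E k))) bZ.
- split.
  + by move=> Y [k _ []] /bounded_funE.
  + by exists 0%N => //; have [] := filt_lat 0%N.
  + move=> Y Y' [k _ kY] [l _ lY']; exists (maxn k l) => //.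
    have [_ _ MD _ _] := filt_lat (maxn k l).
    by apply: MD; [apply: up kY; exact: leq_maxl|apply: up lY'; exact: leq_maxr].
  + by move=> a Y [k _ kY]; exists k => //; have [_ _ _ MZ _] := filt_lat k; exact: MZ.
  + move=> Y Y' [k _ kY] [l _ lY']; exists (maxn k l) => //.
    have [_ _ _ _ MM] := filt_lat (maxn k l).
    by apply: MM; [apply: up kY; exact: leq_maxl|apply: up lY'; exact: leq_maxr].
- move=> A [k _ kA]; exists k => //.
  exact: (@bmeas_indic R _ (g_sigma_algebraType _)).
- move=> Y [k _ kY]; split; first exact: bmeas_sub (@filt_measurable E k) _ kY.
  exact: k_step_filt kY.
- exact: markov_at_limit.
Qed.

Lemma markov_k_step k : bmeas measurable `<=` markov_at -> k_step_markov P rho k.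
Proof.
move=> mkv t x f bf.
have := mkv (fun w' => f [tuple Xt i.+1 w' | i < k]) _ x t; apply.
apply: (bmeas_sub (@filt_measurable E k)).
by apply: (@bmeas_filt_tuple E R k k f (fun i => i.+1)).
Qed.

Lemma markov_one_step : bmeas measurable `<=` markov_at -> one_step_markov P rho.
Proof.
move=> mkv t x f bf.
have := mkv (f \o Xt 1) _ x t.
rewrite (_ : (f \o Xt 1) \o @Defs.shift E t = fun w => f (Xt t.+1 w)); last first.
  by apply/funext => w; rewrite /= /Xt /Defs.shift addn1.
by apply; apply: bmeas_comp => //; exact: measurable_Xt.
Qed.

(** * From one step to k steps under time consistency *)

Lemma time_consistent_eq t (x : E) (Y Z : Omega E -> R) :
  time_consistent P rho -> bmeas measurable Y -> bmeas measurable Z ->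
  {ae P x, forall w, risk rho t.+1 x Y w = risk rho t.+1 x Z w} ->
  {ae P x, forall w, risk rho t x Y w = risk rho t x Z w}.
Proof.
move=> tc bY bZ YZ.
have le1 : {ae P x, forall w, risk rho t x Y w <= risk rho t x Z w}.
  by apply: tc => //; apply: filterS YZ => w ->.
have le2 : {ae P x, forall w, risk rho t x Z w <= risk rho t x Y w}.
  by apply: tc => //; apply: filterS YZ => w ->.
by apply: filterS2 le1 le2 => w l1 l2; apply: le_anti; rewrite l1 l2.
Qed.

Hypothesis rho_reg : regular_risk rho.

Lemma one_step_k_step : time_consistent P rho -> one_step_markov P rho ->
  forall k, k_step_markov P rho k.
Proof.
move=> tc one; elim=> [|k IH] t x f bf.
  (* For k = 0 both sides are the risk of a constant. *)
  have nilE (idx : 'I_0 -> nat) : (fun w : Omega E => f [tuple Xt (idx i) w | i < 0]) =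
      cst (f [tuple]).
    by apply/funext => w; congr f; exact: tuple0.
  rewrite (nilE (fun i => t + i.+1)%N) (nilE (fun i => i.+1)).
  apply: filterS (risk_cst t x (f [tuple])) => w ->.
  by apply/esym; apply: (@ae_cst (Xt t w)); exact: (risk_cst 0).
(* Starting the tuple at X_0 makes [Z] F_k-measurable, within reach of the induction hypothesis,
   while its shifts are the (k+1)-step functions. *)
pose Z := fun w : Omega E => f [tuple Xt i w | i < k.+1].
have kZ : bmeas (@filt E k) Z.
  by apply: (@bmeas_filt_tuple E R k k.+1 f (fun i => i)) => // i; exact: leq_ord.
have bZ : bmeas measurable Z := bmeas_sub (@filt_measurable E k) kZ.
have mZ := k_step_filt IH kZ.
pose F : borel E -> R := fun y => risk0 rho y Z.
have bF : bmeas measurable F := rho_reg bZ.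
have tower s (y : E) : {ae P y, forall w,
    risk rho s y (Z \o @Defs.shift E s.+1) w = risk rho s y (F \o Xt s.+1) w}.
  have sF : bmeas (@filt E s.+1) (F \o Xt s.+1).
    apply: (@bmeas_comp _ _ _ (g_sigma_algebraType _) _ F) => //.
    by move=> _ B mB; rewrite setTI; exact: (filt_Xt (leqnn _)).
  apply: time_consistent_eq => //.
  - by apply: bmeas_comp => //; exact: measurable_shift.
  - exact: bmeas_sub (@filt_measurable E s.+1) _ sF.
  - by apply: filterS2 (mZ y s.+1) (riskS_measurable y sF) => w -> ->.
have shiftE s : Z \o @Defs.shift E s.+1 =
    fun w => f [tuple Xt (s + i.+1) w | i < k.+1].
  apply/funext => w; congr f; apply: eq_mktuple => i.
  by rewrite /Xt /Defs.shift addSnnS.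
have shift1 : (fun w => f [tuple Xt i.+1 w | i < k.+1]) = Z \o @Defs.shift E 1.
  exact: esym (shiftE 0%N).
rewrite -shiftE shift1.
(* This reduces the left side to the time 0 risk of F(X_1) under the law started at X_t(w); [tower]
   at time 0 under that law identifies it with the risk of the shifted [Z]. *)
apply: filterS2 (tower t x) (one t x F bF) => w -> ->.
by apply/esym; apply: (@ae_cst (Xt t w)); exact: (tower 0%N).
Qed.

End risk_family.

(** * The starting point of the chain *)

Lemma polish_closed1 (R : realType) (E : topologicalType) (x : E) :
  polish R E -> closed [set x].
Proof.
move=> [_ [dist [[d0 dE _ _] nbhsE _]]].
rewrite -[[set x]]setCK; apply: open_closedC; rewrite openE => y /= /eqP yx.
apply/nbhsE; exists (dist y x).
  by rewrite lt_neqAle d0 andbT; apply/eqP => /esym/dE /eqP; rewrite (negbTE yx).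
by move=> z /= + zx; rewrite zx ltxx.
Qed.

Lemma ae_full d (T : measurableType d) (R : realType)
    (mu : {measure set T -> \bar R}) (A : set T) :
  measurable A -> mu setT = 1%E -> mu A = 1%E -> {ae mu, forall w, A w}.
Proof.
move=> mA muT muA; exists (~` A); split=> //; first exact: measurableC.
rewrite -setTD measureD //; last by rewrite [ltLHS]muT ltry.
by rewrite setTI -(subee (x := 1%E)) //; congr (_ - _)%E; [exact: muT|exact: muA].
Qed.

(** The metric on [E] makes singletons closed, hence Borel; so X_0 = x is an event, and its mass 1
    means that it holds almost surely. *)
Lemma chain_start (R : realType) (E : ptopologicalType)
    (P : R.-pker (borel E) ~> (Omega E)) : polish R E -> markov_chain P ->
  forall x : E, {ae P x, forall w : Omega E, Xt 0 w = x :> E}.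
Proof.
move=> pE [P0 _] x.
pose A : set (Omega E) := Xt 0 @^-1` [set x].
have mA : measurable A.
  apply: filt_measurable; apply: (filt_Xt (leqnn 0)).
  rewrite -[[set x]]setCK; apply: measurableC; apply: sub_sigma_algebra.
  by apply: closed_openC; exact: polish_closed1 pE.
by apply: (ae_full mA); [exact: prob_kernel|exact: P0].
Qed.

Theorem proposition2p11 (R : realType) (E : ptopologicalType)
    (P : R.-pker (borel E) ~> (Omega E)) (rho : risk_family R E)
    (E_polish : polish R E) (P_chain : markov_chain P)
    (rho_dyn : dynamic_risk_family P rho) (rho_reg : regular_risk rho)
    (rho_cont : continuous_above_below P rho) :
  (markov_property P rho <-> forall k : nat, k_step_markov P rho k) /\
  (time_consistent P rho ->
    (markov_property P rho <-> one_step_markov P rho)).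
Proof.
have start := chain_start E_polish P_chain.
(* The regularity half of the Markov property is a hypothesis, leaving only the identity for each
   [Z]. *)
have markovE : markov_property P rho <-> bmeas measurable `<=` markov_at P rho.
  split=> [[_ mkv] Z bZ x t|mkv]; first exact: mkv.
  by split=> // x Z t bZ; exact: mkv.
have steps : (forall k, k_step_markov P rho k) -> markov_property P rho.
  by move=> kstep; apply/markovE; exact: k_steps_markov.
split=> [|tc]; split.
- by move=> /markovE mkv k; exact: markov_k_step.
- exact: steps.
- by move=> /markovE; exact: markov_one_step.
- by move=> one; apply: steps; exact: one_step_k_step.
Qed.
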